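(* Let $\mathcal M:\mathcal H\rightrightarrows\mathcal H$ be maximal monotone, $S\subset\mathcal H$ a linear subspace, $\mathcal A:=\mathcal M^\#$ the partial inverse of $\mathcal M$ with respect to $S$, and $S_0\subset S\subset S_1$ subspaces of $\mathcal H$. Let $K_0:=S\cap S_0^\perp$, $K_1:=S^\perp\cap S_1$, $H_*:=S_0\oplus S_1^\perp$, $H_{**}:=K_0\oplus K_1$. Let $c_k>0$, let $A_k:S_0\to S_0$ and $C_k:S_1^\perp\to S_1^\perp$ be self-adjoint and positive definite, let $B_k:=A_kP_{S_0}+C_k^{-1}P_{S_1^\perp}$, and let $B_{k,*}:=B_k|_{H_*}$. Given $x^{\#,k}\in\mathcal H$, write $z_0^k:=P_{S_0}x^{\#,k}$, $w_1^k:=P_{S_1^\perp}x^{\#,k}$, $x_*^k:=z_0^k+w_1^k$. A point $x^{\#,k+1}\in\mathcal H$ satisfies $$0\in\mathcal A(x^{\#,k+1})+c_k^{-1}B_k(x^{\#,k+1}-x^{\#,k})$$ if and only if there is a pair $(\widehat z^{k+1},\widehat w^{k+1})\in\operatorname{gph}\mathcal M$ such that $$\begin{aligned}&P_{S_0}\widehat w^{k+1}+c_k^{-1}A_k(P_{S_0}\widehat z^{k+1}-z_0^k)=0,\qquad P_{K_0}\widehat w^{k+1}=0,\\&P_{K_1}\widehat z^{k+1}=0,\qquad P_{S_1^\perp}\widehat z^{k+1}+c_k^{-1}C_k^{-1}(P_{S_1^\perp}\widehat w^{k+1}-w_1^k)=0,\end{aligned}\tag{G}$$ and $x^{\#,k+1}=P_S\widehat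 z^{k+1}+P_{S^\perp}\widehat w^{k+1}$. For such a realization, set $$x_*^{k+1}:=P_{S_0}\widehat z^{k+1}+P_{S_1^\perp}\widehat w^{k+1},\qquad x_{**}^{k+1}:=P_{K_0}\widehat z^{k+1}+P_{K_1}\widehat w^{k+1}.$$ Then $$0\in\mathcal A_*(x_*^{k+1})+c_k^{-1}B_{k,*}(x_*^{k+1}-x_*^k),\qquad x_{**}^{k+1}\in\mathcal A_{**}\bigl(x_*^{k+1},-c_k^{-1}B_{k,*}(x_*^{k+1}-x_*^k)\bigr).$$ The system (G) is also equivalent to finding $\widehat z^{k+1}$ satisfying $$0\in\mathcal M(\widehat z^{k+1})+N_{K_1^\perp}(\widehat z^{k+1})+c_k^{-1}A_k(P_{S_0}\widehat z^{k+1}-z_0^k)+c_kC_kP_{S_1^\perp}\widehat z^{k+1}-w_1^k,$$ in the sense that $\widehat z^{k+1}$ satisfies this inclusion if and only if there is $\widehat w^{k+1}$ with $(\widehat z^{k+1},\widehat w^{k+1})\in\operatorname{gph}\mathcal M$ satisfying (G).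
   Context: $\mathcal H$ is a finite-dimensional Hilbert space; $P_V$ is the orthogonal projection onto a subspace $V$; $N_V$ is the normal cone mapping of convex analysis (for a subspace $V$, $N_V(z)=V^\perp$ if $z\in V$ and $\emptyset$ otherwise). Spingarn's partial inverse $\mathcal A=\mathcal M^\#$ with respect to $S$: $(x^\#,u^\#)\in\operatorname{gph}\mathcal A$ if and only if some $(z,w)\in\operatorname{gph}\mathcal M$ satisfies $$x^\#=P_Sz+P_{S^\perp}w,\qquad u^\#=P_Sw+P_{S^\perp}z.$$ One has orthogonal decompositions $S=S_0\oplus K_0$, $S^\perp=K_1\oplus S_1^\perp$, $\mathcal H=H_*\oplus H_{**}$; the operator $B_k$ is self-adjoint positive semidefinite with range $H_*$ and kernel $H_{**}$. Relative to $\mathcal H=H_*\oplus H_{**}$ write $x=(x_*,x_{**})$. The projected mapping $\mathcal A_*:H_*\rightrightarrows H_*$ and completion mapping $\mathcal A_{**}:H_*\times H_*\rightrightarrows H_{**}$ of $\mathcal A$ are defined by $$u_*\in\mathcal A_*(x_* )\iff\exists x_{**}\in H_{**}\text{ such that }(u_*,0)\in\mathcal A(x_*,x_{**}),$$ $$\mathcal A_{**}(x_*,u_* ):=\{x_{**}\in H_{**}\mid(u_*,0)\in\mathcal A(x_*,x_{**})\}.$$ *)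

(* Defs.v *)
From HB Require Import structures.
From mathcomp Require Import all_boot all_order all_algebra.
From mathcomp Require Import boolp classical_sets reals.

Set Implicit Arguments.
Unset Strict Implicit.
Unset Printing Implicit Defensive.

Import Order.TTheory GRing.Theory Num.Theory.
Local Open Scope classical_set_scope.
Local Open Scope ring_scope.

(* A finite-dimensional real Hilbert space is a [vectType]
   over a [realType] with a positive definite symmetric bilinear form
   [dot : {dot H for idfun}]. A set-valued mapping H ⇉ H' is a function
   [H -> set H'], so [T x u] reads u ∈ T(x). *)

Section Subspaces.
Variables (R : realType) (H : vectType R).

Definition vsum (U V : {vspace H}) (u : subvs_of U) (v : subvs_of V) :
  subvs_of (U + V)%VS := Subvs (memv_add (subvsP u) (subvsP v)).

Definition restr (U : {vspace H}) (B : H -> H) (BU : forall x, B x \in U)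
  (x : subvs_of U) : subvs_of U := Subvs (BU (vsval x)).

End Subspaces.

Section Operators.
Variables (R : realType) (H : vectType R) (dot : {dot H for idfun}).

(* The projection onto V parallel to its orthogonal complement, as a map
   H -> V. *)
Definition oproj (V : {vspace H}) (x : H) : subvs_of V :=
  Subvs (memv_pi V (orthov dot V) x).

Definition self_adjoint (V : {vspace H}) (A : 'End(subvs_of V)) :=
  forall u v, dot (vsval (A u)) (vsval v) = dot (vsval u) (vsval (A v)).

Definition positive_definite (V : {vspace H}) (A : 'End(subvs_of V)) :=
  forall u, u != 0 -> 0 < dot (vsval (A u)) (vsval u).

Definition gph (T : H -> set H) : set (H * H) := [set p | T p.1 p.2].

Definition monotone (T : H -> set H) :=
  forall x u y v, gph T (x, u) -> gph T (y, v) -> 0 <= dot (x - y) (u - v).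

Definition maximal_monotone (T : H -> set H) :=
  monotone T /\
  forall T', monotone T' -> gph T `<=` gph T' -> gph T' `<=` gph T.

Definition normal_cone (D : set H) (z : H) : set H :=
  [set v | D z /\ forall y, D y -> dot v (y - z) <= 0].

Definition partial_inverse (S : {vspace H}) (T : H -> set H) : H -> set H :=
  fun x => [set u | exists z w, [/\ gph T (z, w),
    x = vsval (oproj S z) + vsval (oproj (orthov dot S) w) &
    u = vsval (oproj S w) + vsval (oproj (orthov dot S) z)]].

(* In the next two definitions H = U ⊕ W, the point (x_*, x_** ) being
   x_* + x_**. *)
Definition projected (U W : {vspace H}) (T : H -> set H) :
    subvs_of U -> set (subvs_of U) :=
  fun x => [set u | exists y : subvs_of W,
    T (vsval (vsum x y)) (vsval (vsum u (0 : subvs_of W)))].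

Definition completion (U W : {vspace H}) (T : H -> set H) :
    subvs_of U -> subvs_of U -> set (subvs_of W) :=
  fun x u => [set y |
    T (vsval (vsum x y)) (vsval (vsum u (0 : subvs_of W)))].

(* For a positive definite C, the pseudo-inverse [(C^-1)%VF] of the library is
   the two-sided inverse of C. *)
Definition metricB (V W : {vspace H}) (A : 'End(subvs_of V))
  (C : 'End(subvs_of W)) (x : H) : H :=
  vsval (A (oproj V x)) + vsval ((C^-1)%VF (oproj W x)).

Lemma metricB_in (V W : {vspace H}) (A : 'End(subvs_of V))
  (C : 'End(subvs_of W)) (x : H) : metricB A C x \in (V + W)%VS.
Proof. exact: memv_add (subvsP _) (subvsP _). Qed.

End Operators.

Arguments projected {R H} U W T x.
Arguments completion {R H} U W T x u.

(* Main.v *)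
(** Write P_V for the orthogonal projection.  Since S = S0 ⊕ K0 and
    S^⊥ = K1 ⊕ S1^⊥, every vector is the sum of its projections onto the mutually
    orthogonal spaces S0, K0, K1, S1^⊥, so a vector equation splits into four.  If
    x = P_S z + P_{S^⊥} w, then P_{S0} x = P_{S0} z and P_{S1^⊥} x = P_{S1^⊥} w, and the
    inclusion for the partial inverse reads
    P_S w + P_{S^⊥} z + c^-1 B(x - xk) = 0, whose four components are (G).  In the
    primal inclusion the K1 component is free, because the normal cone to K1^⊥ is K1;
    the S1^⊥ component is the last equation of (G) multiplied by c C. *)

Require Import Defs.
From HB Require Import structures.
From mathcomp Require Import all_boot all_order all_algebra.
From mathcomp Require Import boolp classical_sets reals.

Set Implicit Arguments.
Unset Strict Implicit.
Unset Printing Implicit Defensive.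

Import Order.TTheory GRing.Theory Num.Theory.
Local Open Scope classical_set_scope.
Local Open Scope ring_scope.

(** * Orthogonal complements and projections in finite dimension *)

Section OrthogonalProjection.
Variables (R : realType) (H : vectType R) (dot : {dot H for idfun}).
Implicit Types (U V W : {vspace H}) (u v x y z : H).

Local Notation P V x := (vsval (oproj dot V x)).

Lemma dotC u v : dot u v = dot v u.
Proof. by rewrite hermC /= expr0 mul1r. Qed.

Lemma mem_orthovE V u : u \in orthov dot V <-> forall v, v \in V -> dot u v = 0.
Proof. by split=> [/mem_orthovP|ou] //; apply/mem_orthovP. Qed.

Lemma capv_orthov V : (V :&: orthov dot V = 0)%VS.
Proof.
apply/eqP; rewrite -subv0; apply/subvP => u /memv_capP[uV /mem_orthovE oV].
rewrite memv0; apply: contraT => /(@neq0_dnorm_gt0 _ _ _ dot).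
by rewrite oV // ltxx.
Qed.

(** Dimension count: the sum is direct, so it suffices that [orthov dot V] has dimension at least
    dim H - dim V. It contains the kernel of a linear map from H to a space of dimension dim V, and
    rank-nullity applies. *)
Lemma addv_orthov V : (V + orthov dot V = fullv)%VS.
Proof.
apply/eqP; rewrite eqEdim subvf /= dimv_disjoint_sum ?capv_orthov //.
(* The inner products with a basis of V: if they all vanish, the vector is orthogonal to V. *)
pose f x : 'rV[R]_(\dim V) := \row_i dot (vbasis V)`_i x.
have f_lin : linear f.
  by move=> a x y; apply/rowP => i; rewrite !mxE linearD linearZ.
pose f' := HB.pack_for {linear H -> 'rV[R]_(\dim V)} f
  (GRing.isLinear.Build _ _ _ _ f f_lin).
have sub_ker : (lker (linfun f') <= orthov dot V)%VS.
  apply/subvP => x; rewrite memv_ker lfunE /= => /eqP fx0.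
  apply/mem_orthovE => v vV; rewrite (coord_vbasis vV) linear_sum big1 // => i _.
  have := congr1 (fun r : 'rV[R]_(\dim V) => r 0 i) fx0; rewrite !mxE => dx0.
  by rewrite linearZ /= dotC dx0 mulr0.
rewrite -(limg_ker_dim (linfun f') fullv) capfv addnC.
rewrite leq_add ?dimvS // (leq_trans (dimvS (subvf _))) // dimvf.
by rewrite dim_matrix mul1r.
Qed.

(** Decompose x in the double complement as v + w with v in V and w in V^⊥. Pairing x with w leaves
    only the square norm of w, which must be 0. *)
Lemma orthovK V : orthov dot (orthov dot V) = V.
Proof.
apply/esym/eqP; rewrite eqEsubv orthov_sym subvv /=.
apply/subvP => x /mem_orthovE ox.
have: x \in (V + orthov dot V)%VS by rewrite addv_orthov memvf.
case/memv_addP => v vV [w wV def_x]; rewrite def_x.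
suff -> : w = 0 by rewrite addr0.
have: w \in (V :&: orthov dot V)%VS; last by rewrite capv_orthov memv0 => /eqP.
rewrite memv_cap wV andbT; apply: contraT => wNV.
have w0 : w != 0 by apply: contraNneq wNV => ->; rewrite mem0v.
have := @neq0_dnorm_gt0 _ _ _ dot _ w0.
have := ox _ wV; rewrite def_x linearDl /= (dotC v) ((mem_orthovE _ _).1 wV) // add0r => ->.
by rewrite ltxx.
Qed.

Lemma orthovS U V : (U <= V)%VS -> (orthov dot V <= orthov dot U)%VS.
Proof. by move=> UV; rewrite orthov_sym orthovK. Qed.

Lemma orthogonal_add_eq0 V u v :
  u \in V -> v \in orthov dot V -> u + v = 0 -> u = 0 /\ v = 0.
Proof.
move=> uV vV uv0; have def_v : v = - u by apply/eqP; rewrite -addr_eq0 addrC uv0.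
have: u \in (V :&: orthov dot V)%VS by rewrite memv_cap uV -memvN -def_v.
by rewrite capv_orthov memv0 def_v => /eqP->; rewrite oppr0.
Qed.

Lemma oproj_linear V : linear (fun x => oproj dot V x).
Proof. by move=> a x y; apply: val_inj; rewrite /= linearP. Qed.

HB.instance Definition _ V := GRing.isLinear.Build R H (subvs_of V) _
  (oproj dot V) (oproj_linear V).

Lemma oprojD V x y : oproj dot V (x + y) = oproj dot V x + oproj dot V y.
Proof. exact: linearD. Qed.

Lemma oprojB V x y : oproj dot V (x - y) = oproj dot V x - oproj dot V y.
Proof. exact: linearB. Qed.

Lemma oproj_id V u : u \in V -> P V u = u.
Proof. by move=> uV; rewrite /= daddv_pi_id ?capv_orthov. Qed.

Lemma oprojD_orthov V x : P V x + P (orthov dot V) x = x.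
Proof.
by rewrite /= orthovK daddv_pi_add ?capv_orthov // addv_orthov memvf.
Qed.

Lemma oproj_eq0 V u : u \in orthov dot V -> oproj dot V u = 0.
Proof.
move=> uV; apply: val_inj; apply: (addIr (P (orthov dot V) u)).
by rewrite oprojD_orthov oproj_id // add0r.
Qed.

Lemma oproj_eq0P V u : oproj dot V u = 0 -> u \in orthov dot V.
Proof. by move=> u0; rewrite -(oprojD_orthov V u) u0 add0r subvsP. Qed.

Lemma oproj_uniq V x u : u \in V -> x - u \in orthov dot V -> P V x = u.
Proof.
by move=> uV ou; rewrite -[x](subrK u) oprojD oproj_eq0 // add0r oproj_id.
Qed.

Lemma oproj_orthov V x : x - P V x \in orthov dot V.
Proof. by rewrite -{1}(oprojD_orthov V x) addrC addKr subvsP. Qed.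

Lemma oproj_add U V u v :
  u \in U -> v \in V -> (V <= orthov dot U)%VS -> P U (u + v) = u.
Proof. by move=> uU vV VU; apply: oproj_uniq => //; rewrite addrC addKr (subvP VU). Qed.

Lemma oproj_comp U V x : (U <= V)%VS -> oproj dot U (P V x) = oproj dot U x.
Proof.
move=> UV; apply/val_inj/esym/oproj_uniq; first exact: subvsP.
rewrite -[X in X - _](subrK (P V x)) -addrA.
by rewrite memvD ?oproj_orthov // (subvP (orthovS UV)) ?oproj_orthov.
Qed.

Lemma oprojD_cap U V x :
  (U <= V)%VS -> P V x = P U x + P (V :&: orthov dot U) x.
Proof.
move=> UV; have x_y : x - P V x \in orthov dot V by exact: oproj_orthov.
(* The difference P_V x - P_U x is identified as the projection onto V ∩ U^⊥: it lies in that space,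
   and the remainder x - P_V x + P_U x is orthogonal to it. *)
rewrite (@oproj_uniq (V :&: orthov dot U) x (P V x - P U x)) ?subrKC //.
  by rewrite memv_cap memvB ?subvsP ?(subvP UV _ (subvsP _)) // -(oproj_comp x UV) oproj_orthov.
apply/mem_orthovE => v /memv_capP[vV /mem_orthovE vU].
rewrite opprB addrA addrAC linearDl /= ((mem_orthovE _ _).1 x_y) // add0r.
by rewrite dotC vU // memv_pi.
Qed.

(** A subspace contains both z + y and z - y for each of its vectors y, so testing the inequality at
    both turns it into an equality. *)
Lemma normal_coneP V z v :
  normal_cone dot [set` V] z v <-> z \in V /\ v \in orthov dot V.
Proof.
split=> [[/= zV Nv]|[zV /mem_orthovE ov]].
  split=> //; apply/mem_orthovE => y yV; apply/eqP; rewrite eq_le; apply/andP; split.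
    by have := Nv _ (memvD zV yV); rewrite addrAC subrr add0r.
  have := Nv _ (memvB zV yV).
  by rewrite addrAC subrr add0r linearN /= oppr_le0.
by split=> // y /= yV; rewrite ov // memvB.
Qed.

(** Injectivity is what makes [(C^-1)%VF] a genuine inverse of the endomorphism, on both sides. *)
Lemma positive_definite_ker V (C : 'End(subvs_of V)) :
  positive_definite dot C -> lker C == 0%VS.
Proof.
move=> Cpos; rewrite -subv0; apply/subvP => u; rewrite memv_ker memv0 => /eqP Cu0.
by apply: contraT => /Cpos; rewrite Cu0 linear0l ltxx.
Qed.

End OrthogonalProjection.

(** * The splitting of H into S0, K0, K1 and S1^⊥ *)

Section Splitting.
Variables (R : realType) (H : vectType R) (dot : {dot H for idfun}).
Variables S S0 S1 : {vspace H}.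
Hypotheses (S0S : (S0 <= S)%VS) (SS1 : (S <= S1)%VS).

Local Notation P V x := (vsval (oproj dot V x)).
Local Notation So := (orthov dot S).
Local Notation S1p := (orthov dot S1).
Local Notation K0 := (S :&: orthov dot S0)%VS.
Local Notation K1 := (So :&: S1)%VS.

Lemma oproj_splitr x : P So x = P K1 x + P S1p x.
Proof. by rewrite (oprojD_cap _ _ (orthovS dot SS1)) orthovK addrC. Qed.

Lemma oproj_split x : x = P S0 x + P K0 x + (P K1 x + P S1p x).
Proof. by rewrite -oproj_splitr -(oprojD_cap _ _ S0S) oprojD_orthov. Qed.

(** Orthogonality is used in two levels: first S against S^⊥, then S0 against K0 and S1^⊥ against
    K1. *)
Lemma split_eq0 (a : subvs_of S0) (b : subvs_of K0) (d : subvs_of K1)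
    (e : subvs_of S1p) :
  vsval a + vsval b + (vsval d + vsval e) = 0 <->
  [/\ a = 0, b = 0, d = 0 & e = 0].
Proof.
split=> [|[-> -> -> ->]]; last by rewrite !addr0.
have /memv_capP[bS bS0] := subvsP b; have /memv_capP[dSo dS1] := subvsP d.
have eSo : vsval e \in So by rewrite (subvP (orthovS dot SS1)) ?subvsP.
have abS : vsval a + vsval b \in S by rewrite memvD ?(subvP S0S _ (subvsP a)).
move=> /(orthogonal_add_eq0 abS (memvD dSo eSo))[].
move=> /(orthogonal_add_eq0 (subvsP a) bS0)[a0 b0].
have {}dS1 : vsval d \in orthov dot S1p by rewrite orthovK.
rewrite addrC => /(orthogonal_add_eq0 (subvsP e) dS1)[e0 d0].
by split; apply: val_inj.
Qed.

Lemma oproj_vsuml (a : subvs_of S0) (e : subvs_of S1p) :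
  oproj dot S0 (vsval (vsum a e)) = a.
Proof.
apply: val_inj.
exact: oproj_add (subvsP a) (subvsP e) (orthovS dot (subv_trans S0S SS1)).
Qed.

Lemma oproj_vsumr (a : subvs_of S0) (e : subvs_of S1p) :
  oproj dot S1p (vsval (vsum a e)) = e.
Proof.
have S0S1 : (S0 <= orthov dot S1p)%VS by rewrite orthovK (subv_trans S0S).
have := oproj_add (subvsP e) (subvsP a) S0S1.
by rewrite addrC => ?; apply: val_inj.
Qed.

Lemma oproj_starl z w : oproj dot S0 (P S z + P So w) = oproj dot S0 z.
Proof.
rewrite oprojD oproj_comp // [X in _ + X]oproj_eq0 ?addr0 //.
by rewrite (subvP (orthovS dot S0S)) ?subvsP.
Qed.

Lemma oproj_starr z w : oproj dot S1p (P S z + P So w) = oproj dot S1p w.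
Proof.
rewrite oprojD (oproj_comp _ _ (orthovS dot SS1)) oproj_eq0 ?add0r //.
by rewrite orthovK (subvP SS1) ?subvsP.
Qed.

End Splitting.

Theorem proposition5p2 (R : realType) (H : vectType R) (dot : {dot H for idfun})
    (M : H -> set H) (S S0 S1 : {vspace H}) (c : R)
    (A : 'End(subvs_of S0)) (C : 'End(subvs_of (orthov dot S1))) (xk : H) :
  maximal_monotone dot M ->
  (S0 <= S)%VS -> (S <= S1)%VS ->
  0 < c ->
  self_adjoint dot A -> positive_definite dot A ->
  self_adjoint dot C -> positive_definite dot C ->
  let P := @oproj R H dot in
  let MS := partial_inverse dot S M in
  let S1p := orthov dot S1 in
  let K0 := (S :&: orthov dot S0)%VS in
  let K1 := (orthov dot S :&: S1)%VS in
  let Hs := (S0 + S1p)%VS in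
  let Hss := (K0 + K1)%VS in
  let B := metricB dot A C in
  let Bs : subvs_of Hs -> subvs_of Hs := restr (metricB_in dot A C) in
  let z0 := P S0 xk in
  let w1 := P S1p xk in
  let xs_k : subvs_of Hs := vsum z0 w1 in
  let G (z w : H) :=
    [/\ P S0 w + c^-1 *: A (P S0 z - z0) = 0,
        P K0 w = 0,
        P K1 z = 0 &
        P S1p z + c^-1 *: (C^-1)%VF (P S1p w - w1) = 0] in
  let realizes (x z w : H) :=
    [/\ gph M (z, w), G z w &
        x = vsval (P S z) + vsval (P (orthov dot S) w)] in
  [/\ (forall x : H,
        [set a + c^-1 *: B (x - xk) | a in MS x] 0 <->
        exists z w, realizes x z w),
      (forall x z w : H, realizes x z w ->
        let xs : subvs_of Hs := vsum (P S0 z) (P S1p w) in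
        let xss : subvs_of Hss := vsum (P K0 z) (P K1 w) in
        [set a + c^-1 *: Bs (xs - xs_k) | a in projected Hs Hss MS xs] 0 /\
        completion Hs Hss MS xs (- (c^-1 *: Bs (xs - xs_k))) xss) &
      (forall z : H,
        [set m + n + c^-1 *: vsval (A (P S0 z - z0))
             + c *: vsval (C (P S1p z)) - vsval w1
          | m in M z & n in normal_cone dot [set` orthov dot K1] z] 0 <->
        exists w, gph M (z, w) /\ G z w)].
Proof.
move=> _ S0S SS1 c0 _ _ _ Cpos P MS S1p K0 K1 Hs Hss B Bs z0 w1 xs_k G realizes.
have cN0 : c != 0 by rewrite gt_eqF.
have CK := lker0_lfunK (positive_definite_ker Cpos).
have CVK := lker0_lfunVK (positive_definite_ker Cpos).
(* The value of B(x - xk) at x = P_S z + P_{S^⊥} w, since B sees only the S0 and S1^⊥ components of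
   x. *)
pose q z w : H := vsval (A (P S0 z - z0)) + vsval ((C^-1)%VF (P S1p w - w1)).
have PS x : vsval (P S x) = vsval (P S0 x) + vsval (P K0 x).
  exact: oprojD_cap.
have PSo x : vsval (P (orthov dot S) x) = vsval (P K1 x) + vsval (P S1p x).
  exact: oproj_splitr.
have BE z w : B (vsval (P S z) + vsval (P (orthov dot S) w) - xk) = q z w.
  by rewrite /B /metricB !oprojB oproj_starl // oproj_starr.
have GE z w : G z w <->
    vsval (P S w) + vsval (P (orthov dot S) z) + c^-1 *: q z w = 0.
  rewrite PS PSo scalerDr.
  rewrite addrACA (addrAC (vsval (P S0 w))) -(addrA (vsval (P K1 z))).
  apply: iff_sym.
  exact: (split_eq0 S0S SS1
    (P S0 w + c^-1 *: A (P S0 z - z0)) (P K0 w)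
    (P K1 z) (P S1p z + c^-1 *: (C^-1)%VF (P S1p w - w1))).
split.
- move=> x; split.
  + move=> [_ [z [w [Mzw -> ->]]]]; rewrite BE => /GE Gzw.
    by exists z, w.
  + move=> [z [w [Mzw Gzw ->]]].
    exists (vsval (P S w) + vsval (P (orthov dot S) z)); first by exists z, w.
    by rewrite BE; apply/GE.
- move=> x z w [Mzw Gzw _] xs xss.
  have xsE : vsval (vsum xs xss) = vsval (P S z) + vsval (P (orthov dot S) w).
    by rewrite PS PSo (addrC (vsval (P K1 w))) addrACA.
  have qE : B (vsval (xs - xs_k)) = q z w.
    have -> : vsval (xs - xs_k) = vsval xs - vsval xs_k by [].
    by rewrite /B /metricB !oprojB !(oproj_vsuml S0S SS1) !(oproj_vsumr S0S SS1).
  (* The pair (z, w) itself witnesses membership in the graph of the partial inverse; the inclusion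
     in the projected mapping then follows with [xss] as completion. *)
  have compl : completion Hs Hss MS xs (- (c^-1 *: Bs (xs - xs_k))) xss.
    exists z, w; split=> //; rewrite -[LHS]/(- (c^-1 *: B (vsval (xs - xs_k))) + 0).
    rewrite qE addr0; apply/eqP; rewrite eq_sym -addr_eq0; apply/eqP; exact/GE.
  split=> //; exists (- (c^-1 *: Bs (xs - xs_k))); last exact: addNr.
  by exists xss.
- move=> z.
  (* The terms are sorted by component; n joins the K1 part, as it will lie in K1^⊥⊥ = K1. *)
  have regroup m n : m + n + c^-1 *: vsval (A (P S0 z - z0))
        + c *: vsval (C (P S1p z)) - vsval w1 =
      vsval (P S0 m) + c^-1 *: vsval (A (P S0 z - z0)) + vsval (P K0 m) +
      (vsval (P K1 m) + n +
       (vsval (P S1p m) + (c *: vsval (C (P S1p z)) - vsval w1))).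
    rewrite {1}(oproj_split dot S0S SS1 m).
    by rewrite (@GRing.add H).[AC (2*2*1*1*1*1) ((1*6*2)*((3*5)*(4*(7*8))))].
  have G4E w : P S1p z + c^-1 *: (C^-1)%VF (P S1p w - w1) = 0 <->
      P S1p w + (c *: C (P S1p z) - w1) = 0.
    (* Multiplication by c C is injective, so it loses nothing in the last equation of (G). *)
    have -> : P S1p w + (c *: C (P S1p z) - w1) =
        c *: C (P S1p z + c^-1 *: (C^-1)%VF (P S1p w - w1)).
      by rewrite linearD linearZ /= scalerDr scalerA mulfV // scale1r CVK addrCA.
    split=> [->|/eqP]; first by rewrite linear0 scaler0.
    rewrite scaler_eq0 (negPf cN0) /= => /eqP C0.
    by rewrite -[LHS]CK C0 linear0.
  split.
  + move=> [m Mzm [n /normal_coneP[zK1]]]; rewrite orthovK => nK1.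
    rewrite regroup => /(split_eq0 S0S SS1 (P S0 m + c^-1 *: A (P S0 z - z0))
      (P K0 m) (P K1 m + Subvs nK1) (P S1p m + (c *: C (P S1p z) - w1))).
    move=> [G1 G2 _ /G4E G4].
    by exists m; split=> //; split=> //; exact: oproj_eq0.
  + move=> [w [Mzw [G1 G2 G3 /G4E G4]]].
    (* The normal vector is chosen to cancel the K1 component of w, which (G) leaves
       unconstrained. *)
    exists w => //; exists (- vsval (P K1 w)).
      by apply/normal_coneP; rewrite orthovK memvN subvsP (oproj_eq0P G3).
    rewrite regroup; apply/(split_eq0 S0S SS1
      (P S0 w + c^-1 *: A (P S0 z - z0)) (P K0 w) (P K1 w - P K1 w)
      (P S1p w + (c *: C (P S1p z) - w1))).
    by rewrite subrr.
Qed.
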